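(* $\mathscr{G}(1,3)=\mathscr{G}_1(1,3)$, $\mathscr{G}(1,4)=\mathscr{G}_1(1,4)$ and $\mathscr{G}(1,5)=\mathscr{G}_1(1,5)\cup\mathscr{G}_2(1,5)$.
   Context: Graphs are finite, simple and undirected; eigenvalues are those of the adjacency matrix. An eigenvalue of $G$ is main if it has an eigenvector with nonzero entry sum. For integers $a,b$, $\mathscr{G}(a,b)$ is the set of connected graphs with exactly two main eigenvalues satisfying $\sum_{u\in N(v)}d(u)=a\,d(v)+b$ for every vertex $v$. For $b\ge1$, $\mathscr{G}_1(1,b)$ is the set of connected graphs $G$ having a partition $V(G)=C_1\cup C_2$ into nonempty cells and integers $i,j\ge 1$ with $ij=b$ and $j\neq 1+i$, such that every vertex of $C_1$ has exactly $1$ neighbour in $C_1$ and exactly $i$ neighbours in $C_2$, and every vertex of $C_2$ has exactly $j$ neighbours in $C_1$ and none in $C_2$ (a $2$-equitable partition with parameters $(1,i;j,0)$). The set $\mathscr{G}_2(1,5)$ consists of all connected graphs $G$ of the following form, for some integer $t\ge 3$: $V(G)=V_1\cup V_2\cup V_3\cup V_4$ (disjoint), $V_k=\{v_1^{(k)},\dots,v_t^{(k)}\}$ for $k=1,2,3$, $|V_4|=3t$; choose two arbitrary bijections $\varphi,\psi:\{1,2,3\}\times\{1,\dots,t\}\to V_4$. The edge set consists exactly of: $v_i^{(1)}\varphi(j,i)$ for $i=1,\dots,t$, $j=1,2,3$; $v_i^{(1)}v_i^{(2)}$; $v_i^{(2)}\psi(1,i)$ and $v_i^{(2)}\psi(2,i)$;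 $v_i^{(3)}\psi(3,i)$ (all for $i=1,\dots,t$); and the edges of some $2$-regular graph on vertex set $V_3$. *)

(* Defs.v *)
From HB Require Import structures.
From mathcomp Require Import all_boot all_order all_algebra.
Set Implicit Arguments.
Unset Strict Implicit.
Unset Printing Implicit Defensive.
Import GRing.Theory Num.Theory.

Record sgraph := SGraph {
  vertex : finType;
  edge : rel vertex;
  edge_sym : symmetric edge;
  edge_irrefl : irreflexive edge
}.

Definition nbhd (G : sgraph) (v : vertex G) : {set vertex G} :=
  [set u | edge v u].

Definition deg (G : sgraph) (v : vertex G) : nat := #|nbhd v|.

Definition connected (G : sgraph) : Prop :=
  0 < #|vertex G| /\ forall x y : vertex G, connect (@edge G) x y.

Local Open Scope ring_scope.

(* Rows and columns are indexed by the enumeration of the vertices. *)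
Definition adjmx (R : rcfType) (G : sgraph) : 'M[R]_#|vertex G| :=
  \matrix_(i, j) (edge (enum_val i) (enum_val j))%:R.

(* The matrix is symmetric, so left eigenvectors (the library convention) and
   right eigenvectors agree. *)
Definition main_eigenvalue (R : rcfType) (G : sgraph) (mu : R) : Prop :=
  eigenvalue (adjmx R G) mu /\
  exists2 x : 'rV[R]_#|vertex G|,
    (x <= eigenspace (adjmx R G) mu)%MS & \sum_i x 0 i != 0.

Definition exactly_two_main_eigenvalues (R : rcfType) (G : sgraph) : Prop :=
  exists mu1 mu2 : R, mu1 != mu2 /\
    forall mu : R, main_eigenvalue G mu <-> mu = mu1 \/ mu = mu2.

Definition classG (R : rcfType) (a b : int) (G : sgraph) : Prop :=
  [/\ connected G,
      exactly_two_main_eigenvalues R G &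
      forall v : vertex G,
        \sum_(u in nbhd v) (deg u)%:Z = a * (deg v)%:Z + b].

Local Close Scope ring_scope.

(* G_1(1, b): the partition {C1, C2} is equitable with parameters (1, i; j, 0). *)
Definition classG1 (b : nat) (G : sgraph) : Prop :=
  connected G /\
  exists (C1 C2 : {set vertex G}) (i j : nat),
    [/\ C1 :|: C2 = [set: vertex G], [disjoint C1 & C2],
        C1 != set0 & C2 != set0] /\
    [/\ 1 <= i, 1 <= j, i * j = b & j <> 1 + i] /\
    (forall v, v \in C1 -> #|nbhd v :&: C1| = 1 /\ #|nbhd v :&: C2| = i) /\
    (forall v, v \in C2 -> #|nbhd v :&: C1| = j /\ #|nbhd v :&: C2| = 0).

(* The elements 1, 2, 3 of the index set {1,2,3}, encoded as 'I_3. *)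
Definition k1 : 'I_3 := @Ordinal 3 0 isT.
Definition k2 : 'I_3 := @Ordinal 3 1 isT.
Definition k3 : 'I_3 := @Ordinal 3 2 isT.

(* Each edge in one orientation. Here v (k, i) is the i-th vertex of V_k, and
   H is the 2-regular graph on V_3, transported to the indices. *)
Inductive arcG2 (V : Type) (t : nat) (v phi psi : 'I_3 * 'I_t -> V)
    (H : rel 'I_t) : V -> V -> Prop :=
  | arc_v1_phi i j : arcG2 v phi psi H (v (k1, i)) (phi (j, i))
  | arc_v1_v2 i : arcG2 v phi psi H (v (k1, i)) (v (k2, i))
  | arc_v2_psi1 i : arcG2 v phi psi H (v (k2, i)) (psi (k1, i))
  | arc_v2_psi2 i : arcG2 v phi psi H (v (k2, i)) (psi (k2, i))
  | arc_v3_psi3 i : arcG2 v phi psi H (v (k3, i)) (psi (k3, i))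
  | arc_v3_v3 i j : H i j -> arcG2 v phi psi H (v (k3, i)) (v (k3, j)).

(* G_2(1, 5). Injectivity of v makes
   V_1, V_2, V_3 disjoint sets of size t; V_4 is the rest of the vertices. *)
Definition classG2 (G : sgraph) : Prop :=
  connected G /\
  exists (t : nat) (v : 'I_3 * 'I_t -> vertex G) (V4 : {set vertex G})
         (phi psi : 'I_3 * 'I_t -> vertex G) (H : rel 'I_t),
    [/\ 3 <= t, injective v, V4 = ~: (v @: setT) & #|V4| = 3 * t] /\
    [/\ injective phi, phi @: setT = V4, injective psi & psi @: setT = V4] /\
    [/\ symmetric H, irreflexive H & forall i, #|[set j | H i j]| = 2] /\
    (forall x y, edge x y <->
       arcG2 v phi psi H x y \/ arcG2 v phi psi H y x).

(* Main.v *)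
(* Since [A 1 = d] and [A d = a d + b 1], every main eigenvalue is a root of
   [x^2 = a x + b]; conversely, if [G] is not regular, then [d - nu 1] is an
   eigenvector for the other root [mu], and its entry sum is
   [|d - nu 1|^2 / (mu - nu)], which is nonzero. So having exactly two main
   eigenvalues amounts to being nonregular.

   For [a = 1] the excesses [deg u - 1] over each neighbourhood add up to [b].
   A pendant vertex, or a vertex of degree [b + 1], forces all degrees into
   [{1, b + 1}]; otherwise a vertex of degree [b] forces them into [{2, b}].
   The degrees left are [{2, 3}] for [b = 3, 4], and [{2, 3, 4}] for [b = 5].
   Two degrees [1 + i] and [j] with [i j = b] make the degree classes a
   2-equitable partition with parameters (1, i; j, 0). In the case [{2, 3, 4}],
   the classes V_1, V_4 are the vertices of degree 4 and 2, and V_2, V_3 are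
   those of degree 3 with and without a neighbour of degree 4; double counting
   edges between the classes gives their sizes. *)
Require Import Defs.
From HB Require Import structures.
From mathcomp Require Import all_boot all_order all_algebra.
From mathcomp Require Import zify ring lra.

Set Implicit Arguments.
Unset Strict Implicit.
Unset Printing Implicit Defensive.
Import Order.TTheory GRing.Theory Num.Theory.

Local Open Scope ring_scope.

(** * Main eigenvalues under the degree-sum condition *)

Definition degcol (R : rcfType) (G : sgraph) : 'cV[R]_#|vertex G| :=
  \col_i (deg (enum_val i))%:R.

Lemma adjmx_tr (R : rcfType) (G : sgraph) : (adjmx R G)^T = adjmx R G.
Proof. by apply/matrixP => i j; rewrite !mxE edge_sym. Qed.

Lemma adjmx_mul_col (R : rcfType) (G : sgraph) (f : vertex G -> R) :
  adjmx R G *m (\col_i f (enum_val i)) =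
  \col_i \sum_(u in nbhd (enum_val i)) f u.
Proof.
apply/matrixP => i j; rewrite !mxE [RHS]big_mkcond /=.
rewrite (reindex (@enum_val _ (vertex G))) /=; last first.
  by apply: onW_bij; apply: enum_val_bij.
by apply: eq_bigr => k _; rewrite !mxE inE; case: edge; rewrite ?mul1r ?mul0r.
Qed.

Lemma adjmx_mul_ones (R : rcfType) (G : sgraph) :
  adjmx R G *m const_mx 1 = degcol R G.
Proof.
have -> : const_mx 1 = \col_i (fun=> 1) (enum_val i) :> 'cV[R]_#|vertex G|.
  by apply/matrixP => i j; rewrite !mxE.
rewrite (adjmx_mul_col (fun=> 1)); apply/matrixP => i j; rewrite !mxE.
by rewrite sumr_const.
Qed.

Lemma row_sum_mul_ones (R : rcfType) (n : nat) (x : 'rV[R]_n) :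
  (x *m const_mx 1 : 'M_1) = (\sum_i x 0 i)%:M.
Proof.
apply/matrixP => i j; rewrite !mxE !ord1 eqxx mulr1n.
by apply: eq_bigr => k _; rewrite mxE mulr1.
Qed.

Lemma adjmx_mul_degcol (R : rcfType) (a b : int) (G : sgraph) :
  (forall v : vertex G,
     \sum_(u in nbhd v) (deg u)%:Z = a * (deg v)%:Z + b) ->
  adjmx R G *m degcol R G = a%:~R *: degcol R G + b%:~R *: const_mx 1.
Proof.
move=> Hd; rewrite (adjmx_mul_col (fun u => (deg u)%:R)).
apply/matrixP => i j; rewrite !mxE mulr1.
have := congr1 (fun z : int => z%:~R : R) (Hd (enum_val i)).
rewrite rmorph_sum rmorphD rmorphM /= => <-.
by apply: eq_bigr => u _.
Qed.

(** Let [s] be the nonzero entry sum of an eigenvector [x]. Then [x d = x A 1 = mu s], so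
    multiplying [A d = a d + b 1] by [x] gives [mu^2 s = a mu s + b s], and [s] cancels. *)
Lemma main_eigenvalue_root (R : rcfType) (a b : int) (G : sgraph) (mu : R) :
  (forall v : vertex G,
     \sum_(u in nbhd v) (deg u)%:Z = a * (deg v)%:Z + b) ->
  main_eigenvalue G mu -> mu ^+ 2 = a%:~R * mu + b%:~R.
Proof.
move=> /(adjmx_mul_degcol R) Hd [_ [x /eigenspaceP xA sx]].
have x1 := row_sum_mul_ones x; set s := \sum_i _ in sx x1.
have xD : x *m degcol R G = mu *: s%:M.
  by rewrite -adjmx_mul_ones mulmxA xA -scalemxAl x1.
have := congr1 (mulmx x) Hd; rewrite mulmxA xA -scalemxAl xD.
rewrite mulmxDr -!scalemxAr xD x1 => /matrixP/(_ 0 0).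
rewrite !mxE eqxx !mulr1n => e; apply: (mulIf sx); by rewrite mulrDl -!mulrA -e.
Qed.

(** Here [A 1 = r 1], so an eigenvector with entry sum [s] satisfies [mu s = r s]. This rules out
    two distinct main eigenvalues in a regular graph. *)
Lemma regular_main_eigenvalue (R : rcfType) (G : sgraph) (r : nat) (mu : R) :
  (forall v : vertex G, deg v = r) -> main_eigenvalue G mu -> mu = r%:R.
Proof.
move=> Hr [_ [x /eigenspaceP xA sx]].
have x1 := row_sum_mul_ones x; set s := \sum_i _ in sx x1.
have := congr1 (mulmx x) (adjmx_mul_ones R G).
have -> : degcol R G = r%:R *: const_mx 1.
  by apply/matrixP => i j; rewrite !mxE Hr mulr1.
rewrite mulmxA xA -scalemxAl -scalemxAr x1 => /matrixP/(_ 0 0).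
by rewrite !mxE eqxx !mulr1n => /(mulIf sx).
Qed.

Lemma main_eigenvalue_of_root (R : rcfType) (a b : int) (G : sgraph)
    (mu nu : R) (u v : vertex G) :
  (forall v : vertex G,
     \sum_(u in nbhd v) (deg u)%:Z = a * (deg v)%:Z + b) ->
  deg u <> deg v -> mu != nu -> mu + nu = a%:~R -> mu * nu = - b%:~R ->
  main_eigenvalue G mu.
Proof.
move=> /(adjmx_mul_degcol R) Hd Huv munu hs hp.
pose w (c : R) : 'cV_#|vertex G| := degcol R G - c *: const_mx 1.
(* Stated for an arbitrary pair of roots, so that it applies to [mu] and [nu] in both orders. *)
have Aw c c' : c + c' = a%:~R -> c * c' = - b%:~R ->
    adjmx R G *m w c' = c *: w c'.
  move=> cs cp; rewrite /w mulmxBr Hd -scalemxAr adjmx_mul_ones.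
  rewrite scalerBr scalerA cp scaleNr opprK -cs scalerDl.
  by rewrite addrAC addrK.
have wmu := Aw _ _ hs hp.
have wnu : adjmx R G *m w mu = nu *: w mu by apply: Aw; rewrite 1?addrC 1?mulrC.
(* [eigenspace] consists of row vectors; symmetry of the matrix lets the column eigenvector be
   transposed. *)
have wmuT : (w nu)^T *m adjmx R G = mu *: (w nu)^T.
  by rewrite -[in LHS]adjmx_tr -trmx_mul wmu linearZ.
(* Eigenvectors of a symmetric matrix for distinct eigenvalues are orthogonal. *)
have orth : (w nu)^T *m w mu = 0.
  have : (w nu)^T *m adjmx R G *m w mu = nu *: ((w nu)^T *m w mu).
    by rewrite -mulmxA wnu -scalemxAr.
  rewrite wmuT -scalemxAl => /eqP; rewrite -subr_eq0 -scalerBl scaler_eq0.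
  by rewrite subr_eq0 (negbTE munu) => /eqP.
have nzw : w nu != 0.
  apply/eqP => w0; apply: Huv.
  have Hc (z : vertex G) : (deg z)%:R = nu.
    have /matrixP/(_ (enum_rank z) 0) := w0.
    by rewrite !mxE enum_rankK mulr1 => /eqP; rewrite subr_eq0 => /eqP.
  by apply/eqP; rewrite -(eqr_nat R) !Hc.
(* Since [w nu = w mu + (mu - nu) 1], a zero entry sum would make [w nu] orthogonal to both
   summands, hence to itself, and so zero. *)
have sw : \sum_i (w nu)^T 0 i != 0.
  apply/eqP => s0; move/eqP: nzw; apply.
  have w1 : (w nu)^T *m const_mx 1 = 0 :> 'M_1.
    by rewrite row_sum_mul_ones s0; apply/matrixP => i j; rewrite !mxE mul0rn.
  have : (w nu)^T *m w nu = 0.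
    have {2}-> : w nu = w mu + (mu - nu) *: const_mx 1.
      by rewrite /w scalerBl addrA subrK.
    by rewrite mulmxDr -scalemxAr orth w1 scaler0 addr0.
  move=> /matrixP/(_ 0 0); rewrite !mxE => /eqP.
  rewrite psumr_eq0 => [/allP h|i _]; last by rewrite !mxE -expr2 sqr_ge0.
  apply/matrixP => i j; rewrite [j]ord1 [RHS]mxE.
  have := h i (mem_index_enum _); rewrite /= mxE -expr2 sqrf_eq0.
  by move/eqP.
split; last first.
  by exists (w nu)^T => //; apply/eigenspaceP.
apply/eigenvalueP; exists (w nu)^T => //.
by rewrite trmx_eq0.
Qed.

(** The hypothesis says that [x^2 = a x + b] has positive discriminant, so it has two distinct roots
    in the real closed field. They are the only candidates for main eigenvalues, and nonregularity
    makes both of them main. *)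
Lemma classG_degree (R : rcfType) (a b : int) (G : sgraph) :
  0 < a ^+ 2 + 4 * b ->
  classG R a b G <->
  [/\ connected G,
      exists u v : vertex G, deg u <> deg v &
      forall v : vertex G,
        \sum_(u in nbhd v) (deg u)%:Z = a * (deg v)%:Z + b].
Proof.
move=> Hab; split=> [[Hc [mu1 [mu2 [mu12 Hmu]]] Hd]|[Hc [u [v Huv]] Hd]].
  split=> //.
  case: Hc => n0 _; have /card_gt0P[x _] := n0.
  case: (boolP [forall v : vertex G, deg v == deg x]) => [/forallP Hr|].
    have Hr' (v : vertex G) : deg v = deg x by apply/eqP; apply: Hr.
    case/eqP: mu12.
    rewrite (regular_main_eigenvalue Hr' ((Hmu mu1).2 (or_introl erefl))).
    by rewrite (regular_main_eigenvalue Hr' ((Hmu mu2).2 (or_intror erefl))).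
  by rewrite negb_forall => /existsP[v /eqP Hv]; exists v, x.
split=> //.
pose D : R := (a ^+ 2 + 4 * b)%:~R.
have D0 : 0 < D by rewrite ltr0z.
have sD : Num.sqrt D ^+ 2 = a%:~R ^+ 2 + 4 * b%:~R.
  by rewrite sqr_sqrtr ?ltW // /D rmorphD rmorphM rmorphXn.
have s0 : 0 < Num.sqrt D by rewrite sqrtr_gt0.
set s := Num.sqrt D in sD s0; clearbody s.
pose mu1 : R := (a%:~R + s) / 2; pose mu2 : R := (a%:~R - s) / 2.
have ne : mu1 != mu2.
  have e : mu1 - mu2 = s by rewrite /mu1 /mu2; lra.
  by rewrite -subr_eq0 e gt_eqF.
have hs : mu1 + mu2 = a%:~R by rewrite /mu1 /mu2; lra.
have hp : mu1 * mu2 = - b%:~R by rewrite /mu1 /mu2; lra.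
clearbody mu1 mu2.
exists mu1, mu2; split=> // mu; split=> [/(main_eigenvalue_root Hd) h|].
  have : (mu - mu1) * (mu - mu2) = 0.
    have -> : (mu - mu1) * (mu - mu2) =
      mu ^+ 2 - ((mu1 + mu2) * mu - mu1 * mu2).
      by ring.
    by rewrite h hs hp opprK subrr.
  by move/eqP; rewrite mulf_eq0 !subr_eq0 => /orP[]/eqP ->; [left|right].
case=> ->; first exact: main_eigenvalue_of_root Hd Huv ne hs hp.
by apply: (main_eigenvalue_of_root Hd Huv _ (etrans (addrC _ _) hs));
  rewrite 1?eq_sym // mulrC.
Qed.

Local Close Scope ring_scope.

(** * The condition for [a = 1] and equitable partitions into two cells *)

Definition degree_sum (b : nat) (G : sgraph) : Prop :=
  forall v : vertex G, \sum_(u in nbhd v) deg u = deg v + b.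

(** For [a = 1] the discriminant is [1 + 4 b], which is positive. From here on only degrees in [nat]
    are involved. *)
Lemma classG_degree_sum (R : rcfType) (b : nat) (G : sgraph) : 0 < b ->
  classG R 1%Z b%:Z G <->
  [/\ connected G, exists u v : vertex G, deg u <> deg v & degree_sum b G].
Proof.
move=> b0; rewrite classG_degree; last by lia.
have sumZ (v : vertex G) :
    (\sum_(u in nbhd v) (deg u)%:Z = (\sum_(u in nbhd v) deg u)%:Z)%R.
  by rewrite (big_morph Posz PoszD erefl).
by split=> -[Hc Hr Hd]; split=> // v; have := Hd v; rewrite sumZ; lia.
Qed.

Definition nbhd_deg (G : sgraph) (v : vertex G) (k : nat) : {set vertex G} :=
  [set u in nbhd v | deg u == k].

Lemma in_nbhd_deg (G : sgraph) (u v : vertex G) (k : nat) :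
  (u \in nbhd_deg v k) = edge v u && (deg u == k).
Proof. by rewrite !inE. Qed.

Lemma two_cells_deg (G : sgraph) (C1 C2 : {set vertex G}) (v : vertex G) :
  C1 :|: C2 = [set: vertex G] -> [disjoint C1 & C2] ->
  deg v = #|nbhd v :&: C1| + #|nbhd v :&: C2|.
Proof.
move=> Hu Hd; rewrite /deg -[in LHS](setIT (nbhd v)) -Hu setIUr cardsU.
by rewrite setIACA setIid (disjoint_setI0 Hd) setI0 cards0 subn0.
Qed.

Lemma two_cells_sum (G : sgraph) (C1 C2 : {set vertex G}) (p q : nat)
    (v : vertex G) :
  C1 :|: C2 = [set: vertex G] -> [disjoint C1 & C2] ->
  (forall u, u \in C1 -> deg u = p) -> (forall u, u \in C2 -> deg u = q) ->
  \sum_(u in nbhd v) deg u = #|nbhd v :&: C1| * p + #|nbhd v :&: C2| * q.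
Proof.
move=> Hu Hd Hp Hq; have C2E : C2 = ~: C1.
  rewrite -setTD -Hu setDUl setDv set0U; apply/esym/setDidPl.
  by rewrite disjoint_sym.
rewrite (big_setID C1) setDE -C2E /=.
rewrite (eq_bigr (fun=> p)) => [|u /setIP[_ /Hp] //].
rewrite sum_nat_const (eq_bigr (fun=> q)) => [|u /setIP[_ /Hq] //].
by rewrite sum_nat_const.
Qed.

(** Degrees are [1 + i] on [C1] and [j] on [C2]. The neighbour degrees add up to [(1 + i) + i j] in
    the first case and to [j (1 + i)] in the second, each exceeding the degree by [i j = b]. *)
Lemma classG1_sound (b : nat) (G : sgraph) : classG1 b G ->
  (exists u v : vertex G, deg u <> deg v) /\ degree_sum b G.
Proof.
case=> _ [C1 [C2 [i [j [[Hu Hd /set0Pn[x1 x1C] /set0Pn[x2 x2C]]]]]]].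
case=> -[i0 j0 ij ne] [H1 H2].
have cell v : v \in C1 \/ v \in C2.
  by have := in_setT v; rewrite -Hu inE => /orP.
have degE v := two_cells_deg v Hu Hd.
have d1 v : v \in C1 -> deg v = 1 + i by rewrite degE => /H1[-> ->].
have d2 v : v \in C2 -> deg v = j by rewrite degE => /H2[-> ->]; lia.
split; first by exists x1, x2; rewrite (d1 _ x1C) (d2 _ x2C); lia.
move=> v; rewrite degE (two_cells_sum v Hu Hd d1 d2).
by case: (cell v) => [/H1|/H2] [-> ->]; nia.
Qed.

(** At each vertex, the degree and the sum of the neighbour degrees are two linear equations in the
    numbers of neighbours in the two cells. Their determinant is [j - (1 + i)] up to sign, so the
    solution is unique, and it is the required one. *)
Lemma classG1_two_degrees (b i j : nat) (G : sgraph) :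
  connected G -> degree_sum b G -> 0 < i -> 0 < j -> i * j = b ->
  j <> 1 + i -> (forall v : vertex G, deg v = 1 + i \/ deg v = j) ->
  classG1 b G.
Proof.
move=> Hc Hs i0 j0 ij ne Hdeg; split=> //.
pose C1 := [set v : vertex G | deg v == 1 + i].
pose C2 := [set v : vertex G | deg v == j].
have d1 v : v \in C1 -> deg v = 1 + i by rewrite inE => /eqP.
have d2 v : v \in C2 -> deg v = j by rewrite inE => /eqP.
have cell v : v \in C1 \/ v \in C2.
  by case: (Hdeg v) => /eqP h; [left|right]; rewrite inE.
have Hu : C1 :|: C2 = [set: vertex G].
  by apply/setP => v; rewrite !inE; case: (Hdeg v) => ->; rewrite eqxx ?orbT.
have Hd : [disjoint C1 & C2].
  apply/pred0P => v /=; rewrite !inE; apply/negbTE/negP => /andP[/eqP-> /eqP].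
  by lia.
have H1 v : v \in C1 -> #|nbhd v :&: C1| = 1 /\ #|nbhd v :&: C2| = i.
  move=> vC; have := Hs v.
  rewrite (two_cells_sum v Hu Hd d1 d2).
  move: (two_cells_deg v Hu Hd); rewrite (d1 _ vC).
  by move: #|_| #|_| => x y; nia.
have H2 v : v \in C2 -> #|nbhd v :&: C1| = j /\ #|nbhd v :&: C2| = 0.
  move=> vC; have := Hs v.
  rewrite (two_cells_sum v Hu Hd d1 d2).
  move: (two_cells_deg v Hu Hd); rewrite (d2 _ vC).
  by move: #|_| #|_| => x y; nia.
(* Either cell yields a vertex of the other, because [i] and [j] are positive. *)
have nz (A B : {set vertex G}) k : #|A :&: B| = k -> 0 < k -> B != set0.
  by move=> <-; rewrite card_gt0; apply: contraNneq => ->; rewrite setI0.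
have [x _] : exists x : vertex G, true.
  by case: Hc => /card_gt0P[x _] _; exists x.
suff [nz1 nz2] : C1 != set0 /\ C2 != set0 by exists C1, C2, i, j.
have [/H1[a1 a2]|/H2[a1 a2]] := cell x.
  by split; [apply: (nz _ _ _ a1)|apply: (nz _ _ _ a2)].
have nz1 := nz _ _ _ a1 j0; split=> //.
have /set0Pn[y yC] := nz1.
by have [_ a3] := H1 y yC; apply: (nz _ _ _ a3).
Qed.

(** * Extremal degrees propagating through a connected graph *)

Lemma connected_all (G : sgraph) (P : pred (vertex G)) (x : vertex G) :
  connected G -> P x -> (forall u v, edge u v -> P u -> P v) ->
  forall v, P v.
Proof.
move=> [_ Hc] Px Hcl v.
have cs : connect_sym (@edge G).
  by apply: sym_connect_sym => ? ?; rewrite edge_sym.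
have cl : closed (@edge G) P by apply: intro_closed => // u w; exact: Hcl.
by have := closed_connect cl (Hc x v); rewrite !unfold_in Px => <-.
Qed.

(** An isolated vertex would give [0 = b]. As all degrees are positive, the truncated [.-1] is a
    true subtraction, and subtracting 1 for each neighbour removes [deg v] from the sum. *)
Lemma degree_sum_excess (b : nat) (G : sgraph) : 0 < b -> degree_sum b G ->
  (forall v : vertex G, 0 < deg v) /\
  (forall v : vertex G, \sum_(u in nbhd v) (deg u).-1 = b).
Proof.
move=> b0 Hs.
have pos (v : vertex G) : 0 < deg v.
  rewrite lt0n; apply/eqP => d0; have := Hs v; rewrite d0.
  have -> : nbhd v = set0 by apply: cards0_eq.
  by rewrite big_set0; lia.
split=> // v; have := Hs v.
rewrite (eq_bigr (fun u => (deg u).-1 + 1)); last first.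
  by move=> u _; rewrite addn1 prednK.
by rewrite big_split /= sum1_card -[#|_|]/(deg v); lia.
Qed.

(** The excess of [v] is one term of the sum, equal to [b], taken around any neighbour of [v]. *)
Lemma degree_le (b : nat) (G : sgraph) (v : vertex G) : 0 < b ->
  degree_sum b G -> deg v <= b.+1.
Proof.
move=> b0 Hs; have [pos ex] := degree_sum_excess b0 Hs.
have /card_gt0P[u] := pos v; rewrite inE => uv.
have := ex u; rewrite (bigD1 v) /=; last by rewrite inE edge_sym.
by lia.
Qed.

(** The only neighbour of a pendant vertex carries the whole excess [b]. Conversely, next to a
    vertex of degree [b + 1] no excess is left for the other neighbours. Hence the degrees 1 and
    [b + 1] propagate along edges; the parameters are [i = b], [j = 1]. *)
Lemma classG1_pendant (b : nat) (G : sgraph) (x : vertex G) : 0 < b ->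
  connected G -> degree_sum b G -> (deg x == 1) || (deg x == b.+1) ->
  classG1 b G.
Proof.
move=> b0 Hc Hs Hx; have [pos ex] := degree_sum_excess b0 Hs.
have leaf (u v : vertex G) : edge u v -> deg u = 1 -> deg v = b.+1.
  move=> uv /eqP/cards1P[w Hw]; have := ex u; rewrite Hw big_set1.
  have : v \in nbhd u by rewrite inE.
  by rewrite Hw inE => /eqP <-; have := pos v; lia.
apply: (@classG1_two_degrees b b 1) => //; try lia.
move=> v; suff : (deg v == 1) || (deg v == b.+1).
  by case/orP => /eqP ->; [right|left].
apply: (connected_all Hc Hx (P := fun v => (deg v == 1) || (deg v == b.+1))).
move=> {v}u v uv /orP[/eqP/(leaf _ _ uv) ->|/eqP du].
  by rewrite eqxx orbT.
have [//|/eqP n1] := boolP (deg v == 1); apply/eqP.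
have uNv : u \in nbhd v by rewrite inE edge_sym.
(* A second neighbour [w] of [v] is pendant, because [u] uses up the excess at [v]; then [leaf]
   applied to [w] gives the degree of [v]. *)
have /card_gt0P[w] : 0 < #|nbhd v :\ u|.
  by have := pos v; rewrite {1}/deg (cardsD1 u) uNv in n1 *; lia.
rewrite !inE => /andP[wu vw]; apply: (leaf w); first by rewrite edge_sym.
have := ex v; rewrite (bigD1 u) //= (bigD1 w) /=; last by rewrite inE vw.
by have := pos w; lia.
Qed.

(** The [b] neighbours of a vertex of degree [b] have degrees at least 2 with sum [2 b], so all are
    2. The two neighbours of a vertex of degree 2 have degree sum [b + 2], so a neighbour of degree
    [b] forces the other one to have degree 2. The parameters are [i = 1], [j = b]. *)
Lemma classG1_degree_b (b : nat) (G : sgraph) (x : vertex G) : 2 < b ->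
  connected G -> degree_sum b G -> (forall v : vertex G, 1 < deg v) ->
  deg x = b -> classG1 b G.
Proof.
move=> b2 Hc Hs d2 dx.
have big_nbr (u v : vertex G) : edge u v -> deg u = b -> deg v = 2.
  move=> uv du; have vu : v \in nbhd u by rewrite inE.
  have := Hs u; rewrite (big_setD1 v) //= => hs.
  have : \sum_(w in nbhd u :\ v) 2 <= \sum_(w in nbhd u :\ v) deg w.
    by apply: leq_sum => w _.
  have := d2 v; have : deg u = #|nbhd u :\ v|.+1.
    by rewrite /deg (cardsD1 v) vu.
  by rewrite sum_nat_const; move: hs; rewrite du; lia.
have deg2 (u v w : vertex G) : edge u v -> edge u w -> v != w -> deg u = 2 ->
    deg v + deg w = b + 2.
  move=> uv uw vw du; have vu : v \in nbhd u by rewrite inE.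
  have wu : w \in nbhd u :\ v by rewrite !inE eq_sym vw.
  have N0 : nbhd u :\ v :\ w = set0.
    apply: cards0_eq; move: du.
    by rewrite /deg (cardsD1 v) vu (cardsD1 w) wu; lia.
  have := Hs u; rewrite (big_setD1 v) //= (big_setD1 w) //= N0 big_set0 du.
  by lia.
(* Degree 2 alone does not propagate; the neighbour of degree [b] has to be part of the
   invariant. *)
pose P (v : vertex G) :=
  (deg v == b) || (deg v == 2) && [exists u, edge v u && (deg u == b)].
have Px : P x by rewrite /P dx eqxx.
apply: (@classG1_two_degrees b 1 b) => //; try lia.
move=> v; suff : P v by case/orP => [|/andP[]] /eqP ->; [right|left].
apply: (connected_all Hc Px) => {v} u v uv /orP[/eqP du|].
  apply/orP; right; rewrite (big_nbr _ _ uv du) eqxx.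
  by apply/existsP; exists u; rewrite edge_sym uv du eqxx.
case/andP=> /eqP du /existsP[w /andP[uw /eqP dw]].
have [->|vw] := eqVneq v w; first by rewrite /P dw eqxx.
have dv : deg v = 2 by have := deg2 _ _ _ uv uw vw du; lia.
apply/orP; right; rewrite dv eqxx; apply/existsP.
(* Both [u] and [v] have degree 2, so the other neighbour [z] of [v] has degree [b]. *)
have /card_gt0P[z] : 0 < #|nbhd v :\ u|.
  by move: dv; rewrite /deg (cardsD1 u) inE edge_sym uv; lia.
rewrite !inE => /andP[zu vz]; exists z; rewrite vz /=.
have := deg2 v z u vz _ zu dv; rewrite edge_sym => /(_ uv); lia.
Qed.

Lemma classG1_small (b : nat) (G : sgraph) : b = 3 \/ b = 4 ->
  connected G -> degree_sum b G -> classG1 b G.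
Proof.
move=> Hb Hc Hs; have b0 : 0 < b by lia.
have [pos _] := degree_sum_excess b0 Hs.
case: (boolP [exists x : vertex G, (deg x == 1) || (deg x == b.+1)]).
  by case/existsP => x; apply: classG1_pendant.
rewrite negb_exists => /forallP nleaf.
have rng (v : vertex G) : 1 < deg v <= b.
  by have := pos v; have := degree_le v b0 Hs; have := nleaf v; lia.
case: Hb => ?; subst b.
  by apply: (@classG1_two_degrees 3 1 3) => // v; have := rng v; lia.
have [/existsP[x /eqP]|] := boolP [exists x : vertex G, deg x == 4].
  by apply: classG1_degree_b => // v; have := rng v; lia.
rewrite negb_exists => /forallP n4.
(* The degree 3 is [1 + i] and the degree 2 is [j], with [i = j = 2]. *)
apply: (@classG1_two_degrees 4 2 2) => // v.
by have := rng v; have := n4 v; lia.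
Qed.

(** * Graphs in [classG2] satisfy the degree-sum condition *)

Lemma nbhd_seq (G : sgraph) (x : vertex G) (s : seq (vertex G)) :
  uniq s -> (forall u, edge x u <-> u \in s) ->
  deg x = size s /\
  forall F : vertex G -> nat, \sum_(u in nbhd x) F u = \sum_(u <- s) F u.
Proof.
move=> us Hs; have e : nbhd x =i s.
  by move=> u; rewrite inE; apply/idP/idP => /Hs.
split=> [|F]; first by rewrite /deg (eq_card e); apply/card_uniqP.
by rewrite big_uniq //; apply: eq_bigl.
Qed.

Lemma ord3_cases (j : 'I_3) : [\/ j = k1, j = k2 | j = k3].
Proof.
by case: j => -[|[|[|//]]] h; [apply: Or31|apply: Or32|apply: Or33];
  apply: val_inj.
Qed.

(** Explicit neighbour lists give degrees 4, 3, 3, 2 on V_1, V_2, V_3, V_4. The sums to check are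
    [2 + 2 + 2 + 3 = 4 + 5], [4 + 2 + 2 = 3 + 5], [2 + 3 + 3 = 3 + 5] and [4 + 3 = 2 + 5]. *)
Lemma classG2_sound (G : sgraph) : classG2 G ->
  (exists u v : vertex G, deg u <> deg v) /\ degree_sum 5 G.
Proof.
case=> _ [t [v [V4 [phi [psi [H [[t3 vI V4E V4c]]]]]]]].
case=> -[phiI phiV psiI psiV] [[Hsym Hirr H2] He].
have nv4 p : v p \notin V4 by rewrite V4E inE negbK imset_f.
have phi4 p : phi p \in V4 by rewrite -phiV imset_f.
have psi4 p : psi p \in V4 by rewrite -psiV imset_f.
have vphi p q : v p <> phi q by move=> e; have := nv4 p; rewrite e phi4.
have vpsi p q : v p <> psi q by move=> e; have := nv4 p; rewrite e psi4.
(* Arcs are grouped by the cell of their source, which is always a value of [v]. *)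
have arcE x y : arcG2 v phi psi H x y -> 
  (exists i, x = v (k1, i) /\ ((exists j, y = phi (j, i)) \/ y = v (k2, i))) \/
  (exists i, x = v (k2, i) /\ (y = psi (k1, i) \/ y = psi (k2, i))) \/
  (exists i, x = v (k3, i) /\
     (y = psi (k3, i) \/ exists2 j, H i j & y = v (k3, j))).
  by case=> [i j|i|i|i|i|i j hij];
    [left|left|right; left|right; left|right; right|right; right];
    exists i; split=> //; eauto.
have e1 i u : edge (v (k1, i)) u <->
    u \in [:: phi (k1, i); phi (k2, i); phi (k3, i); v (k2, i)].
  rewrite He !inE; split.
    case=> /arcE[[i' []]|[[i' []]|[i' []]]].
    + move=> /vI[->] [[j ->]| ->]; last by rewrite eqxx !orbT.
      by case: (ord3_cases j) => ->; rewrite eqxx ?orbT.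
    + by move=> /vI.
    + by move=> /vI.
    + by move=> _ [[j /vphi]|/vI].
    + by move=> _ [/vpsi|/vpsi].
    + by move=> _ [/vpsi|[j _ /vI]].
  by case/or4P => /eqP ->; left; constructor.
have e2 i u : edge (v (k2, i)) u <->
    u \in [:: v (k1, i); psi (k1, i); psi (k2, i)].
  rewrite He !inE; split.
    case=> /arcE[[i' []]|[[i' []]|[i' []]]].
    + by move=> /vI.
    + by move=> /vI[->] [->| ->]; rewrite eqxx ?orbT.
    + by move=> /vI.
    + by move=> -> [[j /vphi]|/vI[->]] //; rewrite eqxx.
    + by move=> _ [/vpsi|/vpsi].
    + by move=> _ [/vpsi|[j _ /vI]].
  by case/or3P => /eqP ->; [right|left|left]; constructor.
have e3 i u : edge (v (k3, i)) u <->
    u \in psi (k3, i) :: [seq v (k3, j) | j <- enum [set j | H i j]].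
  rewrite He !inE; split.
    case=> /arcE[[i' []]|[[i' []]|[i' []]]].
    + by move=> /vI.
    + by move=> /vI.
    + move=> /vI[->] [->|[j hj ->]]; first by rewrite eqxx.
      by apply/orP; right; apply: map_f; rewrite mem_enum inE.
    + by move=> _ [[j /vphi]|/vI].
    + by move=> _ [/vpsi|/vpsi].
    + move=> -> [/vpsi//|[j hj /vI[->]]].
      by apply/orP; right; apply: map_f; rewrite mem_enum inE Hsym.
  case/orP => [/eqP->|/mapP[j]]; first by left; constructor.
  by rewrite mem_enum inE => hj ->; left; constructor.
pose own (j : 'I_3) := if j == k3 then k3 else k2.
(* A vertex of V_4 has one name under [phi] and one under [psi]. The first determines its neighbour
   in V_1, the second its neighbour in V_2 or V_3, the latter only for index [k3]. *)
have e4 j i j' i' u : phi (j, i) = psi (j', i') -> edge (phi (j, i)) u <->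
    u \in [:: v (k1, i); v (own j', i')].
  move=> e; rewrite He !inE; split.
    case=> /arcE[[m []]|[[m []]|[m []]]].
    + by move/esym/vphi.
    + by move/esym/vphi.
    + by move/esym/vphi.
    + by move=> -> [[n /phiI[_ ->]]|/esym/vphi//]; rewrite eqxx.
    + by move=> -> [|]; rewrite e => /psiI[-> ->]; rewrite eqxx orbT.
    + by move=> -> [|[n _ /esym/vphi//]]; rewrite e => /psiI[-> ->];
        rewrite eqxx orbT.
  case/orP => /eqP ->; right; first by constructor.
  by rewrite e; case: (ord3_cases j') => ->; constructor.
have vphiN p q : (v p == phi q) = false by apply/eqP/vphi.
have vpsiN p q : (v p == psi q) = false by apply/eqP/vpsi.
have phivN p q : (phi p == v q) = false by rewrite eq_sym.
have psivN p q : (psi p == v q) = false by rewrite eq_sym.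
have vE p q : (v p == v q) = (p == q) by apply: inj_eq.
have phiE p q : (phi p == phi q) = (p == q) by apply: inj_eq.
have psiE p q : (psi p == psi q) = (p == q) by apply: inj_eq.
have vE' := (vphiN, vpsiN, phivN, psivN, vE, phiE, psiE, xpair_eqE).
have u1 i : uniq [:: phi (k1, i); phi (k2, i); phi (k3, i); v (k2, i)].
  by rewrite /= !inE !vE'.
have u2 i : uniq [:: v (k1, i); psi (k1, i); psi (k2, i)].
  by rewrite /= !inE !vE'.
have u3 i : uniq (psi (k3, i) :: [seq v (k3, j) | j <- enum [set j | H i j]]).
  rewrite /= map_inj_uniq ?enum_uniq; last by move=> j j' /vI[].
  by rewrite andbT; apply/mapP => -[j _ /esym/vpsi].
have u4 i j i' : uniq [:: v (k1, i); v (own j, i')].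
  by rewrite /= !inE !vE' /own; case: (j == k3).
have d1 i : deg (v (k1, i)) = 4 by have [-> _] := nbhd_seq (u1 i) (e1 i).
have d2 i : deg (v (k2, i)) = 3 by have [-> _] := nbhd_seq (u2 i) (e2 i).
have d3 i : deg (v (k3, i)) = 3.
  by have [-> _] := nbhd_seq (u3 i) (e3 i); rewrite /= size_map -cardE H2.
have d4 x : x \in V4 -> deg x = 2.
  rewrite -psiV => /imsetP[[j' i'] _ e].
  have := psi4 (j', i'); rewrite -phiV => /imsetP[[j i] _ e'].
  have [d _] := nbhd_seq (u4 i j' i') (fun u => e4 _ _ _ _ u (esym e')).
  by rewrite e e' d.
have dpsi p : deg (psi p) = 2 by apply: d4.
have dphi p : deg (phi p) = 2 by apply: d4.
have t0 : 0 < t by lia.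
split.
  by exists (v (k1, Ordinal t0)), (v (k2, Ordinal t0)); rewrite d1 d2.
move=> x; have [/imsetP[[k i] _ ->]|xV4] := boolP (x \in v @: setT).
  case: (ord3_cases k) => ->.
  - have [-> ->] := nbhd_seq (u1 i) (e1 i).
    by rewrite !big_cons big_nil !dphi d2.
  - have [-> ->] := nbhd_seq (u2 i) (e2 i).
    by rewrite !big_cons big_nil !dpsi d1.
  - have [-> ->] := nbhd_seq (u3 i) (e3 i).
    rewrite big_cons dpsi big_map /= size_map -cardE H2.
    by rewrite (eq_bigr (fun=> 3)) // big_enum /= sum_nat_const H2.
have : x \in V4 by rewrite V4E inE.
rewrite -psiV => /imsetP[[j' i'] _ e].
have := psi4 (j', i'); rewrite -phiV => /imsetP[[j i] _ e'].
have [d s] := nbhd_seq (u4 i j' i') (fun u => e4 _ _ _ _ u (esym e')).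
rewrite e e' s d !big_cons big_nil d1 /own.
by case: eqP => _; rewrite ?d2 ?d3.
Qed.

(** * Counting and naming neighbours by degree *)

Lemma sum_nbhd_indicator (G : sgraph) (x : vertex G) (k : nat) :
  \sum_(u in nbhd x) (deg u == k : nat) = #|nbhd_deg x k|.
Proof.
rewrite -sum1_card [RHS](eq_bigl (fun u => (u \in nbhd x) && (deg u == k))).
  by rewrite [RHS]big_mkcondr; apply: eq_bigr => u _; case: eqP.
by move=> u; rewrite inE.
Qed.

(** Taking [F] constant 1 and [F] the identity gives the two linear equations on the three neighbour
    counts. *)
Lemma sum_nbhd_deg234 (G : sgraph) (F : nat -> nat) (x : vertex G) :
  (forall u : vertex G, 1 < deg u < 5) ->
  \sum_(u in nbhd x) F (deg u) =
  #|nbhd_deg x 2| * F 2 + #|nbhd_deg x 3| * F 3 + #|nbhd_deg x 4| * F 4.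
Proof.
move=> Hr; rewrite -!sum_nbhd_indicator !big_distrl -!big_split /=.
apply: eq_bigr => u _; have := Hr u.
by case: (deg u) => [|[|[|[|[|[]]]]]] //= _; lia.
Qed.

(** Both sides count the ordered adjacent pairs with degrees [p] and [q], once from each end. *)
Lemma double_count_degrees (G : sgraph) (p q : nat) :
  \sum_(x : vertex G | deg x == p) #|nbhd_deg x q| =
  \sum_(y : vertex G | deg y == q) #|nbhd_deg y p|.
Proof.
have cE (x : vertex G) k :
    #|nbhd_deg x k| = \sum_(y | deg y == k) (edge x y : nat).
  rewrite -sum_nbhd_indicator big_mkcond [RHS]big_mkcond /=.
  by apply: eq_bigr => u _; rewrite inE; case: edge; case: eqP.
under eq_bigr do rewrite cE; under [RHS]eq_bigr do rewrite cE.
rewrite exchange_big /=; apply: eq_bigr => y _; apply: eq_bigr => x _.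
by rewrite edge_sym.
Qed.

Lemma set_card_enum (T : finType) (A : {set T}) (n : nat) : #|A| = n ->
  exists f : 'I_n -> T, injective f /\ forall x, x \in A <-> exists i, x = f i.
Proof.
move=> <-; exists enum_val; split=> [|x]; first exact: enum_val_inj.
split=> [xA|[i ->]]; last exact: enum_valP.
by exists (enum_rank_in xA x); rewrite enum_rankK_in.
Qed.

(** An arbitrary but fixed numbering, from 0, of the neighbours of degree [k]; the default [x]
    appears only past the last of them. *)
Definition nbr (G : sgraph) (x : vertex G) (k j : nat) : vertex G :=
  nth x (enum (nbhd_deg x k)) j.

Lemma nbrP (G : sgraph) (x : vertex G) (k j : nat) : j < #|nbhd_deg x k| ->
  edge x (nbr x k j) /\ deg (nbr x k j) = k.
Proof.
rewrite cardE => /(mem_nth x); rewrite mem_enum in_nbhd_deg.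
by case/andP=> -> /eqP.
Qed.

Lemma nbr_inj (G : sgraph) (x : vertex G) (k j j' : nat) :
  j < #|nbhd_deg x k| -> j' < #|nbhd_deg x k| -> nbr x k j = nbr x k j' ->
  j = j'.
Proof.
rewrite cardE => hj hj' /eqP.
by rewrite /nbr nth_uniq ?enum_uniq // => /eqP.
Qed.

Lemma nbr_surj (G : sgraph) (x u : vertex G) (k : nat) : edge x u ->
  deg u = k -> exists2 j, j < #|nbhd_deg x k| & u = nbr x k j.
Proof.
move=> xu du; have uN : u \in enum (nbhd_deg x k).
  by rewrite mem_enum in_nbhd_deg xu du eqxx.
exists (index u (enum (nbhd_deg x k))); first by rewrite cardE index_mem.
by rewrite /nbr nth_index.
Qed.

Lemma unique_nbr (G : sgraph) (x u w : vertex G) (k : nat) :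
  #|nbhd_deg x k| = 1 -> edge x u -> deg u = k -> edge x w -> deg w = k ->
  u = w.
Proof.
move=> /eqP/cards1P[z E] xu du xw dw.
have h y : edge x y -> deg y = k -> y = z.
  by move=> xy dy; apply/set1P; rewrite -E in_nbhd_deg xy dy eqxx.
by rewrite (h u xu du) (h w xw dw).
Qed.

(** * Structure of the graphs with degrees 2, 3 and 4 *)

(** Eliminating [c x 2] from the two counting equations leaves [c x 3 + 2 * c x 4 = 5 - deg x]. This
    fixes the neighbour counts for degrees 4 and 2 and leaves two possibilities for degree 3, which
    separate V_2 from V_3. *)
Lemma classG2_degrees (G : sgraph) : connected G -> degree_sum 5 G ->
  (forall x : vertex G, 1 < deg x < 5) -> classG2 G.
Proof.
move=> Hc Hs Hr; split=> //.
pose c (x : vertex G) k := #|nbhd_deg x k|.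
have cD x : c x 2 + c x 3 + c x 4 = deg x.
  have := sum_nbhd_deg234 (fun=> 1) x Hr.
  by rewrite sum1_card !muln1 => <-.
have cS x : c x 2 * 2 + c x 3 * 3 + c x 4 * 4 = deg x + 5.
  by rewrite -Hs (sum_nbhd_deg234 id).
have c4 x : deg x = 4 -> [/\ c x 2 = 3, c x 3 = 1 & c x 4 = 0].
  by have := cD x; have := cS x; split; lia.
have c3 x : deg x = 3 ->
    [/\ c x 2 = 2, c x 3 = 0 & c x 4 = 1] \/
    [/\ c x 2 = 1, c x 3 = 2 & c x 4 = 0].
  have := cD x; have := cS x => ? ? ?.
  have [?|?] : c x 4 = 1 \/ c x 4 = 0 by lia.
    by left; split; lia.
  by right; split; lia.
have c2 x : deg x = 2 -> [/\ c x 2 = 0, c x 3 = 1 & c x 4 = 1].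
  by have := cD x; have := cS x; split; lia.
pose V1 := [set x : vertex G | deg x == 4].
pose V2 := [set x : vertex G | (deg x == 3) && (c x 4 == 1)].
pose V3 := [set x : vertex G | (deg x == 3) && (c x 4 == 0)].
pose V4 := [set x : vertex G | deg x == 2].
pose t := #|V1|.
have sumc p q m : (forall x, deg x = p -> c x q = m) ->
    \sum_(x : vertex G | deg x == p) c x q =
    #|[set x : vertex G | deg x == p]| * m.
  move=> h; rewrite (eq_bigr (fun=> m)); last by move=> x /eqP/h.
  by rewrite sum_nat_const cardsE.
have sum34 : \sum_(x : vertex G | deg x == 3) c x 4 = t.
  by rewrite double_count_degrees (sumc _ _ 1) ?muln1 // => x /c4[].
have V2c : #|V2| = t.
  rewrite -sum34 -sum1_card big_mkcond [RHS]big_mkcond; apply: eq_bigr => x _.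
  by rewrite inE; case: eqP => //= /c3[][_ _ ->].
(* Edges between degrees 2 and 4: one at each vertex of degree 2, three at each vertex of degree
   4. *)
have V4c : #|V4| = 3 * t.
  have := double_count_degrees G 2 4.
  rewrite (sumc _ _ 1); last by move=> x /c2[].
  by rewrite (sumc _ _ 3) -/V1 -/V4 -/t; [lia|move=> x /c4[]].
(* A vertex of degree 3 has [c x 4 + 1] neighbours of degree 2, and a vertex of degree 2 has one of
   degree 3. Hence [3 t = t + n] for the number [n] of vertices of degree 3, and removing the [t]
   vertices of V_2 from [n = 2 t] leaves [t]. *)
have V3c : #|V3| = t.
  have := double_count_degrees G 2 3.
  rewrite (sumc _ _ 1); last by move=> x /c2[].
  rewrite (eq_bigr (fun x => c x 4 + 1)); last first.
    by move=> x /eqP/c3[][]; rewrite /c => -> _ ->.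
  rewrite big_split /= sum34 sum1dep_card -/V4 V4c.
  rewrite -(cardsID V2).
  have -> : [set x : vertex G | deg x == 3] :&: V2 = V2.
    by apply/setP => x; rewrite !inE; case: eqP.
  have -> : [set x : vertex G | deg x == 3] :\: V2 = V3.
    by apply/setP => x; rewrite !inE; case: eqP => // /c3[][_ _ ->].
  by rewrite V2c; lia.
have [a [aI aP]] := set_card_enum (erefl : #|V1| = t).
have [d [dI dP]] := set_card_enum V3c.
have a4 i : deg (a i) = 4.
  by have /(aP _) : exists i', a i = a i' by [exists i]; rewrite inE => /eqP.
have dP' i : deg (d i) = 3 /\ c (d i) 4 = 0.
  have /(dP _) : exists i', d i = d i' by exists i.
  by rewrite inE => /andP[/eqP -> /eqP].
have d3 i : deg (d i) = 3 by case: (dP' i).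
have dc2 i : c (d i) 2 = 1.
  by have [e1 e2] := dP' i; case: (c3 _ e1) => -[]; lia.
have dc3 i : c (d i) 3 = 2.
  by have [e1 e2] := dP' i; case: (c3 _ e1) => -[]; lia.
(* V_2 is indexed through its matching with V_1: [b i] is the unique neighbour of degree 3 of
   [a i]. *)
pose b i := nbr (a i) 3 0.
have ab i : edge (a i) (b i) /\ deg (b i) = 3.
  by apply: nbrP; have [_] := c4 _ (a4 i); rewrite /c => ->.
have b3 i : deg (b i) = 3 by case: (ab i).
have bc i : [/\ c (b i) 2 = 2, c (b i) 3 = 0 & c (b i) 4 = 1].
  case: (c3 _ (b3 i)) => // -[_ _ /cards0_eq h].
  have : a i \in nbhd_deg (b i) 4.
    by rewrite in_nbhd_deg edge_sym a4; case: (ab i) => ->.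
  by rewrite h inE.
have bI : injective b.
  move=> i i' e; apply: aI; have [_ _ h] := bc i.
  apply: (unique_nbr h) => //; rewrite edge_sym; first by case: (ab i).
  by rewrite e; case: (ab i').
have V1P x : deg x = 4 -> exists i, x = a i.
  by move=> /eqP h; apply/aP; rewrite inE.
have V2P x : deg x = 3 -> c x 4 = 1 -> exists i, x = b i.
  move=> dx cx; have /card_gt0P[y] : 0 < c x 4 by rewrite cx.
  rewrite in_nbhd_deg => /andP[xy /eqP /[dup] dy /V1P[i yE]]; exists i.
  have [_ h _] := c4 _ dy; have [e1 e2] := ab i.
  by apply: (unique_nbr h) => //; [rewrite edge_sym|rewrite yE].
have V3P x : deg x = 3 -> c x 4 = 0 -> exists i, x = d i.
  by move=> /eqP h /eqP h'; apply/dP; rewrite inE h h'.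
have bd i i' : b i <> d i'.
  by move=> e; have [_ _] := bc i; have [_] := dP' i'; rewrite e => ->.
pose v (p : 'I_3 * 'I_t) :=
  if p.1 == k1 then a p.2 else if p.1 == k2 then b p.2 else d p.2.
(* [phi] lists the three neighbours of degree 2 of each [a i]; [psi] lists the two of each [b i] and
   the single one of each [d i]. *)
pose phi (p : 'I_3 * 'I_t) := nbr (a p.2) 2 p.1.
pose psi (p : 'I_3 * 'I_t) :=
  if p.1 == k3 then nbr (d p.2) 2 0 else nbr (b p.2) 2 p.1.
(* [own p] is the neighbour of [psi p] in V_2 or V_3. *)
pose own (p : 'I_3 * 'I_t) := if p.1 == k3 then d p.2 else b p.2.
pose H (i j : 'I_t) := edge (d i) (d j).
have phiP p : edge (a p.2) (phi p) /\ deg (phi p) = 2.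
  by apply: nbrP; have [] := c4 _ (a4 p.2); rewrite /c => -> _ _.
have psiP p : edge (own p) (psi p) /\ deg (psi p) = 2.
  case: p => j i; rewrite /own /psi /=.
  case: (ord3_cases j) => -> /=; apply: nbrP.
  - by have [] := bc i; rewrite /c => ->.
  - by have [] := bc i; rewrite /c => ->.
  - by have := dc2 i; rewrite /c => ->.
have own3 p : deg (own p) = 3 by rewrite /own; case: ifP.
have vI : injective v.
  move=> [j i] [j' i']; rewrite /v /=.
  case: (ord3_cases j) => ->; case: (ord3_cases j') => -> //=.
  - by move/aI->.
  - by move=> e; have := b3 i'; rewrite -e a4.
  - by move=> e; have := d3 i'; rewrite -e a4.
  - by move=> e; have := b3 i; rewrite e a4.
  - by move/bI->.
  - by move/bd.
  - by move=> e; have := d3 i; rewrite e a4.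
  - by move/esym/bd.
  - by move/dI->.
have phiI : injective phi.
  move=> [j i] [j' i'] e.
  have [e1 e2] := phiP (j, i); have [e1' _] := phiP (j', i').
  have [_ _ h] := c2 _ e2.
  have /aI ii : a i = a i'.
    by apply: (unique_nbr h) => //; rewrite edge_sym // e.
  subst i'; congr (_, _); apply: val_inj; apply: (nbr_inj _ _ e) => /=;
    by have [] := c4 _ (a4 i); rewrite /c => -> _ _.
have psiI : injective psi.
  move=> [j i] [j' i'] e.
  have [e1 e2] := psiP (j, i); have [e1' _] := psiP (j', i').
  have [_ h _] := c2 _ e2.
  have oo : own (j, i) = own (j', i').
    by apply: (unique_nbr h) => //; rewrite edge_sym // e.
  have cb m : c (b m) 2 = 2 by case: (bc m).
  move: oo e; rewrite /own /psi /=.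
  by case: (ord3_cases j) => ->; case: (ord3_cases j') => -> //=;
    try (by move/bd); try (by move/esym/bd); try (by move/dI->);
    move/bI-> => /nbr_inj; rewrite -/(c _ _) cb => /(_ isT isT).
have phiS x : deg x = 2 -> exists p, x = phi p.
  move=> dx; have [_ _ h] := c2 _ dx.
  have /card_gt0P[y] : 0 < c x 4 by rewrite h.
  rewrite in_nbhd_deg => /andP[xy /eqP /V1P[i yE]]; subst y.
  have [||j hj ->] := @nbr_surj _ (a i) x 2; rewrite 1?edge_sym //.
  have hj3 : j < 3.
    by have [e _ _] := c4 _ (a4 i); move: hj; rewrite -/(c _ _) e.
  by exists (Ordinal hj3, i).
have psiS x : deg x = 2 -> exists2 p, x = psi p & edge x (own p).
  move=> dx; have [_ h _] := c2 _ dx.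
  have /card_gt0P[y] : 0 < c x 3 by rewrite h.
  rewrite in_nbhd_deg => /andP[xy /eqP dy].
  have [j hj xE] : exists2 j, j < c y 2 & x = nbr y 2 j.
    by apply: nbr_surj; rewrite 1?edge_sym.
  case: (c3 _ dy) => -[e1 _ e2].
    have [i yE] := V2P _ dy e2; subst y; move: hj; rewrite e1 => hj.
    have hj3 : j < 3 by lia.
    (* Here [j < 2], so the index differs from [k3] and the branch of [b] is taken. *)
    exists (Ordinal hj3, i); rewrite /psi /own /= ifN //;
      by apply/eqP => -[]; lia.
  have [i yE] := V3P _ dy e2; subst y.
  move: hj; rewrite e1 ltnS leqn0 => /eqP j0.
  by subst j; exists (k3, i).
have V4E : V4 = ~: (v @: setT).
  apply/setP => x; rewrite !inE; apply/idP/idP.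
    move=> /eqP dx; apply/imsetP => -[[j i] _ e]; move: dx; rewrite e /v /=.
    by case: ifP => _; [rewrite a4|case: ifP => _; rewrite ?b3 ?d3].
  apply: contraR => dx; apply/imsetP.
  have [/V1P[i ->]|dx3] : deg x = 4 \/ deg x = 3 by have := Hr x; lia.
    by exists (k1, i).
  case: (c3 _ dx3) => -[_ _ h].
    by have [i ->] := V2P _ dx3 h; exists (k2, i).
  by have [i ->] := V3P _ dx3 h; exists (k3, i).
have phiV : phi @: setT = V4.
  apply/setP => x; rewrite inE; apply/imsetP/eqP => [[p _ ->]|/phiS[p ->]].
    by case: (phiP p).
  by exists p.
have psiV : psi @: setT = V4.
  apply/setP => x; rewrite inE; apply/imsetP/eqP => [[p _ ->]|/psiS[p -> _]].
    by case: (psiP p).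
  by exists p.
(* A neighbour of degree 3 of [d i] has itself a neighbour of degree 3, which a vertex of V_2 does
   not have. *)
have dNd i x : edge (d i) x -> deg x = 3 -> exists2 j, H i j & x = d j.
  move=> dx x3; have x4 : c x 4 = 0.
    case: (c3 _ x3) => -[_ h //].
    have : d i \in nbhd_deg x 3 by rewrite in_nbhd_deg edge_sym dx d3.
    by rewrite (cards0_eq h) inE.
  by have [j e] := V3P _ x3 x4; exists j => //; rewrite /H -e.
have H2 i : #|[set j | H i j]| = 2.
  rewrite -(dc3 i) -(card_imset _ dI); apply: eq_card => x.
  rewrite in_nbhd_deg.
  apply/imsetP/andP => [[j]|[dx /eqP /(dNd _ _ dx)[j hj ->]]].
    by rewrite inE => hj ->; rewrite d3.
  by exists j; rewrite ?inE.
(* Every vertex is within distance 2 of one of degree 4, so [t] is positive. An index together with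
   its two [H]-neighbours then gives three distinct indices. *)
have t3 : 3 <= t.
  have [x _] : exists x : vertex G, true.
    by case: Hc => /card_gt0P[x _] _; exists x.
  have t0 : 0 < t.
    have h4 (y : vertex G) : deg y = 4 -> 0 < t.
      by move=> /V1P[m _]; apply: leq_ltn_trans (ltn_ord m).
    have h2 (y : vertex G) : deg y = 2 -> 0 < t.
      move=> dy; have [_ _ e] := c2 _ dy.
      have /card_gt0P[z] : 0 < c y 4 by rewrite e.
      by rewrite in_nbhd_deg => /andP[_ /eqP/h4].
    have [/h4//|[/h2//|dx]] : deg x = 4 \/ deg x = 2 \/ deg x = 3.
      by have := Hr x; lia.
    have /card_gt0P[z] : 0 < c x 2 by case: (c3 _ dx) => -[->].
    by rewrite in_nbhd_deg => /andP[_ /eqP/h2].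
  have := subset_leq_card (subsetT (Ordinal t0 |: [set j | H (Ordinal t0) j])).
  by rewrite cardsU1 H2 inE /H edge_irrefl cardsT card_ord.
(* No arc of [arcG2] goes up in degree, so edges are oriented towards the smaller degree, and six
   pairs of degrees remain. *)
have edge_arc x y : edge x y -> deg y <= deg x -> arcG2 v phi psi H x y.
  move=> xy yx; have yx' : edge y x by rewrite edge_sym.
  have dx : deg x = 2 \/ deg x = 3 \/ deg x = 4 by have := Hr x; lia.
  have dy : deg y = 2 \/ deg y = 3 \/ deg y = 4 by have := Hr y; lia.
  have absurd k : deg y = k -> c x k = 0 -> arcG2 v phi psi H x y.
    move=> dyk /cards0_eq h; have : y \in nbhd_deg x k.
      by rewrite in_nbhd_deg xy dyk eqxx.
    by rewrite h inE.
  case: dx => [dx|[dx|dx]]; case: dy => [dy|[dy|dy]]; try lia.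
  - by have [h _ _] := c2 _ dx; apply: (absurd 2).
  - have [p yE yo] := psiS _ dy; have [_ h _] := c2 _ dy.
    have -> : x = own p by apply: (unique_nbr h).
    case: p yE {yo} => j i -> {y dy xy yx yx' absurd h}; rewrite /own /=.
    case: (ord3_cases j) => -> /=.
    + exact: (arc_v2_psi1 v phi psi H i).
    + exact: (arc_v2_psi2 v phi psi H i).
    + exact: (arc_v3_psi3 v phi psi H i).
  - case: (c3 _ dx) => -[_ h3 h4]; first exact: (absurd 3).
    have [i xE] := V3P _ dx h4; rewrite xE in xy *.
    by have [j hj ->] := dNd _ _ xy dy; apply: (arc_v3_v3 v phi psi hj).
  - have [[j i] yE] := phiS _ dy; have [_ _ h] := c2 _ dy.
    have [e1 _] := phiP (j, i).
    have -> : x = a i by apply: (unique_nbr h) => //; rewrite edge_sym yE.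
    by rewrite yE; apply: (arc_v1_phi v phi psi H i j).
  - have [i xE] := V1P _ dx; have [_ h _] := c4 _ dx; have [e1 e2] := ab i.
    have -> : y = b i by apply: (unique_nbr h) => //; rewrite xE.
    by rewrite xE; apply: (arc_v1_v2 v phi psi H i).
  - by have [_ _ h] := c4 _ dx; apply: (absurd 4).
exists t, v, V4, phi, psi, H; do !split=> //.
- by move=> i j; rewrite /H edge_sym.
- by move=> i; rewrite /H edge_irrefl.
- move=> xy.
  by case: (leqP (deg y) (deg x)) => [|/ltnW]; [left|right]; apply: edge_arc;
    rewrite // edge_sym.
- have arc_edge p q : arcG2 v phi psi H p q -> edge p q.
    case=> [i j|i|i|i|i|i j //].
    + by case: (phiP (j, i)).
    + by case: (ab i).
    + by case: (psiP (k1, i)).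
    + by case: (psiP (k2, i)).
    + by case: (psiP (k3, i)).
  by case=> /arc_edge //; rewrite edge_sym.
Qed.

(** * The case [b = 5] and the conclusion *)

Lemma classG12_complete (G : sgraph) : connected G -> degree_sum 5 G ->
  classG1 5 G \/ classG2 G.
Proof.
move=> Hc Hs; have [pos _] := degree_sum_excess (isT : 0 < 5) Hs.
case: (boolP [exists x : vertex G, (deg x == 1) || (deg x == 6)]).
  by case/existsP => x; left; apply: (@classG1_pendant 5 G x).
rewrite negb_exists => /forallP nleaf.
have rng (v : vertex G) : 1 < deg v <= 5.
  by have := pos v; have := degree_le v (isT : 0 < 5) Hs; have := nleaf v; lia.
case: (boolP [exists x : vertex G, deg x == 5]).
  case/existsP => x /eqP dx; left; apply: (@classG1_degree_b 5 G x) => // v.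
  by case/andP: (rng v).
rewrite negb_exists => /forallP n5; right; apply: classG2_degrees => // v.
by have := rng v; have := n5 v; lia.
Qed.

Theorem theorem4p7 (R : rcfType) :
  (forall G : sgraph, classG R 1%Z 3%Z G <-> classG1 3 G) /\
  (forall G : sgraph, classG R 1%Z 4%Z G <-> classG1 4 G) /\
  (forall G : sgraph, classG R 1%Z 5%Z G <-> classG1 5 G \/ classG2 G).
Proof.
split; last split; move=> G; apply: (iff_trans (classG_degree_sum R G _)) => //.
- split=> [[Hc _]|h]; first by apply: classG1_small => //; left.
  by have [? ?] := classG1_sound h; case: h.
- split=> [[Hc _]|h]; first by apply: classG1_small => //; right.
  by have [? ?] := classG1_sound h; case: h.
split=> [[Hc _]|[] h]; first exact: classG12_complete.
  by have [? ?] := classG1_sound h; case: h.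
by have [? ?] := classG2_sound h; case: h.
Qed.
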